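(* Let $\beta<2\sqrt{1-c^2}$ and $c^2<1$, and let $$\mathscr N=\{\vec w\in\mathscr X:\ \vec w\neq \vec 0,\ P(\vec w)=0\}.$$ For $\vec\varphi\in\mathscr X$ the following are equivalent: (i) $\vec\varphi\in\vec{\mathscr G}(\beta,c)$; (ii) $\vec\varphi\in\mathscr N$ and $L(\vec\varphi)=\inf\{L(\vec w):\vec w\in\mathscr N\}$.
   Context: Let $p>1$. Let $f\in C^2(\mathbb R)$ be homogeneous of degree $p$, meaning $f(\lambda s)=\lambda^p f(s)$ for all $\lambda>0$ and $s\in\mathbb R$. Put $F(s)=\int_0^s f$, and assume $F$ takes a positive value somewhere. Let $\mathscr X=H^2(\mathbb R)\times L^2(\mathbb R)$ with norm $\|(u,v)\|_{\mathscr X}=\|u\|_{H^2}+\|v\|_{L^2}$. Functionals of one variable: - $I(u)=\int_{\mathbb R}u_{xx}^2-\beta u_x^2+(1-c^2)u^2\,dx$; - $K(u)=(p+1)\int_{\mathbb R}F(u)\,dx$; - $m(\beta,c)=\inf\{I(u)/K(u)^{2/(p+1)}: u\in H^2(\mathbb R),\ K(u)>0\}$. Ground states: $\mathscr G(\beta,c)=\{\varphi\in H^2(\mathbb R): I(\varphi)=K(\varphi)=m(\beta,c)^{(p+1)/(p-1)}\}$. These are solutions of $(1-c^2)\varphi+\beta\varphi''+\varphi''''=f(\varphi)$. Also $\vec{\mathscr G}(\beta,c)=\{(\varphi,-c\varphi):\varphi\in\mathscr G(\beta,c)\}$. Functionals on $\mathscr X$: - $E(u,v)=\int_{\mathbb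 R}\tfrac12(u_{xx}^2-\beta u_x^2+u^2+v^2)-F(u)\,dx$; - $Q(u,v)=\int_{\mathbb R}uv\,dx$; - $L=E+cQ$; - $P(\vec w)=\langle L'(\vec w),\vec w\rangle$, which equals $I(u)-K(u)+\int(cu+v)^2\,dx$ for $\vec w=(u,v)$. *)

(* Defs.v *)
From HB Require Import structures.
From mathcomp Require Import all_boot all_order all_algebra.
From mathcomp Require Import all_classical all_reals all_analysis.
Set Implicit Arguments. Unset Strict Implicit. Unset Printing Implicit Defensive.
Import Order.TTheory GRing.Theory Num.Theory.
Import numFieldNormedType.Exports.
Local Open Scope classical_set_scope.
Local Open Scope ring_scope.

Section Defs.
Variable R : realType.
Local Notation mu := (@lebesgue_measure R).

Definition kdv_C2 (f : R -> R) : Prop :=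
  (forall x, derivable f x 1) /\ (forall x, derivable (derive1 f) x 1) /\
  continuous (derive1 (derive1 f)).

Definition kdv_homogeneous (p : R) (f : R -> R) : Prop :=
  forall l s, 0 < l -> f (l * s) = powR l p * f s.

Definition kdv_primF (f : R -> R) (s : R) : R :=
  if 0 <= s then Rintegral mu `[0, s] f else - Rintegral mu `[s, 0] f.

Definition kdv_L2 (v : R -> R) : Prop :=
  measurable_fun setT v /\ mu.-integrable setT (fun x => (v x ^+ 2)%:E).

(* u in H^2(R), with (continuous) representative u, first derivative u1 and
   second (weak) derivative u2: u, u1, u2 in L^2 and u, u1 absolutely
   continuous with u' = u1, u1' = u2. *)
Definition kdv_isH2 (u u1 u2 : R -> R) : Prop :=
  [/\ kdv_L2 u, kdv_L2 u1, kdv_L2 u2 &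
   forall a b, a <= b ->
     u b - u a = Rintegral mu `[a, b] u1 /\ u1 b - u1 a = Rintegral mu `[a, b] u2].

Definition kdv_Ifun (beta c : R) (u u1 u2 : R -> R) : R :=
  Rintegral mu setT (fun x => u2 x ^+ 2 - beta * u1 x ^+ 2 + (1 - c ^+ 2) * u x ^+ 2).

Definition kdv_Kfun (p : R) (f : R -> R) (u : R -> R) : R :=
  (p + 1) * Rintegral mu setT (fun x => kdv_primF f (u x)).

Definition kdv_mval (p : R) (f : R -> R) (beta c : R) : R :=
  inf [set r | exists u u1 u2, [/\ kdv_isH2 u u1 u2, 0 < kdv_Kfun p f u &
         r = kdv_Ifun beta c u u1 u2 / powR (kdv_Kfun p f u) (2 / (p + 1))]].

Definition kdv_groundState (p : R) (f : R -> R) (beta c : R) (phi : R -> R) : Prop :=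
  exists phi1 phi2, [/\ kdv_isH2 phi phi1 phi2,
    kdv_Ifun beta c phi phi1 phi2 = kdv_Kfun p f phi &
    kdv_Kfun p f phi = powR (kdv_mval p f beta c) ((p + 1) / (p - 1))].

Definition kdv_vecGroundState (p : R) (f : R -> R) (beta c : R) (u v : R -> R) : Prop :=
  kdv_groundState p f beta c u /\ {ae mu, forall x, v x = - c * u x}.

Definition kdv_Efun (p : R) (f : R -> R) (beta : R) (u u1 u2 v : R -> R) : R :=
  Rintegral mu setT (fun x =>
    2^-1 * (u2 x ^+ 2 - beta * u1 x ^+ 2 + u x ^+ 2 + v x ^+ 2) - kdv_primF f (u x)).

Definition kdv_Qfun (u v : R -> R) : R := Rintegral mu setT (fun x => u x * v x).

Definition kdv_Lfun (p : R) (f : R -> R) (beta c : R) (u u1 u2 v : R -> R) : R :=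
  kdv_Efun p f beta u u1 u2 v + c * kdv_Qfun u v.

Definition kdv_Pfun (p : R) (f : R -> R) (beta c : R) (u u1 u2 v : R -> R) : R :=
  kdv_Ifun beta c u u1 u2 - kdv_Kfun p f u + Rintegral mu setT (fun x => (c * u x + v x) ^+ 2).

(* (u,v) is the zero element of X = H^2 x L^2 *)
Definition kdv_Xzero (u v : R -> R) : Prop :=
  {ae mu, forall x, u x = 0} /\ {ae mu, forall x, v x = 0}.

Definition kdv_inN (p : R) (f : R -> R) (beta c : R) (u u1 u2 v : R -> R) : Prop :=
  [/\ kdv_isH2 u u1 u2, kdv_L2 v, ~ kdv_Xzero u v & kdv_Pfun p f beta c u u1 u2 v = 0].

Definition kdv_infLN (p : R) (f : R -> R) (beta c : R) : R :=
  inf [set r | exists u u1 u2 v, kdv_inN p f beta c u u1 u2 v /\ r = kdv_Lfun p f beta c u u1 u2 v].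
End Defs.

(* Main.v *)
(* On the Nehari set one has K = I + J with J = int (c u + v)^2, and then
   L = (p - 1) / (2 (p + 1)) K. Hence m <= I / K^(2/(p+1)) <= K^((p-1)/(p+1)), so that
   K >= m^((p+1)/(p-1)) on the Nehari set. Conversely every u with K(u) > 0 can be dilated onto
   the Nehari set with v = - c u (so J = 0), where K becomes (I / K^(2/(p+1)))^((p+1)/(p-1)).
   Therefore inf L = (p - 1) / (2 (p + 1)) m^((p+1)/(p-1)), and a minimiser is exactly a pair
   with J = 0 and I = K = m^((p+1)/(p-1)).
   The analytic input is m > 0: integrating by parts gives int u1^2 = - int u u2, which makes I
   coercive, and the one-dimensional Sobolev inequality u^2 <= int (u^2 + u1^2) bounds K by a
   power of I. Both rest on a product rule for primitives of L2 functions. *)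
Require Import Defs.
From mathcomp Require Import all_boot all_order all_algebra.
From mathcomp Require Import all_classical all_reals all_analysis.
From mathcomp Require Import measurable_realfun ring lra.
Set Implicit Arguments. Unset Strict Implicit. Unset Printing Implicit Defensive.
Import Order.TTheory GRing.Theory Num.Theory.
Import numFieldNormedType.Exports.
Local Open Scope classical_set_scope.
Local Open Scope ring_scope.

(* [lra] and [ring] fail on the reverse coercion hidden in [Rintegral mu], and treat convertible
   integrals with different implicit structures as different atoms. *)
Ltac generalize_Rintegral :=
  repeat match goal with
    | H := context [@Rintegral _ _ _ _ _ _] |- _ => clearbody H end;
  repeat match goal with
    | H : context [@Rintegral _ _ _ _ _ _] |- _ => revert H end;
  repeat match goal with
    | |- context [@Rintegral ?d ?T ?R ?m ?D ?f] =>
      let a := fresh "I" in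
      pose (a := @Rintegral d T R m D f);
      repeat match goal with
        | |- context [@Rintegral ?d2 ?T2 ?R2 ?m2 ?D2 ?f2] =>
          unify D D2; unify f f2; change (@Rintegral d2 T2 R2 m2 D2 f2) with a end;
      clearbody a end;
  intros.
Ltac ilra := generalize_Rintegral; lra.
Ltac inra := generalize_Rintegral; nra.
Ltac iring := generalize_Rintegral; ring.

(** * Primitives of square-integrable functions *)

Section L2.
Context {R : realType}.
Local Notation mu := (@lebesgue_measure R).
Implicit Types (f g a b A B u v : R -> R) (x y r : R).

Definition L1on (D : set R) f := mu.-integrable D (fun x => (f x)%:E).

Lemma L1on_measurable D f : L1on D f -> measurable_fun D f.
Proof. by case/integrableP => /measurable_EFinP. Qed.

Lemma L1on_dom D f g : measurable D -> measurable_fun D f ->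
  (forall x, D x -> `|f x| <= g x) -> L1on D g -> L1on D f.
Proof.
move=> mD mf fg ig; apply: le_integrable ig => //; first exact/measurable_EFinP.
move=> x Dx /=; rewrite lee_fin; apply: le_trans (fg x Dx) _; exact: ler_norm.
Qed.

Lemma L1onS D E f : measurable D -> measurable E -> D `<=` E ->
  L1on E f -> L1on D f.
Proof. by move=> mD mE DE; apply: integrableS. Qed.

Lemma L1onT D f : measurable D -> L1on setT f -> L1on D f.
Proof. by move=> mD; apply: L1onS. Qed.

Lemma L1onD D f g : measurable D -> L1on D f -> L1on D g ->
  L1on D (fun x => f x + g x).
Proof. by move=> mD fi gi; exact: (@integrableD _ _ _ mu D mD _ _ fi gi). Qed.

Lemma L1onZ D r f : measurable D -> L1on D f -> L1on D (fun x => r * f x).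
Proof. by move=> mD fi; exact: (@integrableZl _ _ _ mu D mD r _ fi). Qed.

Lemma L1onB D f g : measurable D -> L1on D f -> L1on D g ->
  L1on D (fun x => f x - g x).
Proof. by move=> mD fi gi; exact: (@integrableB _ _ _ mu D mD _ _ fi gi). Qed.

Lemma L1on_norm D f : L1on D f -> L1on D (fun x => `|f x|).
Proof. by move=> fi; exact: (@integrable_norm _ _ _ mu D _ fi). Qed.

Lemma L1on_cst_itv x y r : L1on `[x, y] (fun=> r).
Proof.
apply: measurable_bounded_integrable => //.
  by rewrite /= lebesgue_measure_itv/=; case: ifP => // _; rewrite -EFinB ltry.
exact: bounded_cst.
Qed.

Lemma L2_measurable f D : measurable D -> kdv_L2 f -> measurable_fun D f.
Proof. by move=> mD [mf _]; apply: measurable_funS mf. Qed.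

(** From [(|f| - |g|)^2 >= 0], the product is dominated by [f^2 + g^2]. *)
Lemma L2M f g : kdv_L2 f -> kdv_L2 g -> L1on setT (fun x => f x * g x).
Proof.
move=> [mf f2] [mg g2].
apply: (@L1on_dom _ _ (fun x => f x ^+ 2 + g x ^+ 2)) => //.
- exact: measurable_funM.
- move=> x _; have := sqr_ge0 (`|f x| - `|g x|).
  rewrite -(real_normK (num_real (f x))) -(real_normK (num_real (g x))) normrM.
  have := normr_ge0 (f x); have := normr_ge0 (g x).
  by nra.
- exact: L1onD.
Qed.

Lemma L2D f g : kdv_L2 f -> kdv_L2 g -> kdv_L2 (fun x => f x + g x).
Proof.
move=> Lf Lg; split; first by apply: measurable_funD; [case: Lf | case: Lg].
have -> : (fun x => ((f x + g x) ^+ 2)%:E) =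
          (fun x => (f x ^+ 2 + (2 * (f x * g x) + g x ^+ 2))%:E).
  by apply/funext => x; congr EFin; ring.
apply: L1onD => //; first by case: Lf.
by apply: L1onD => //; [apply: L1onZ => //; exact: L2M | case: Lg].
Qed.

Lemma L2Z r f : kdv_L2 f -> kdv_L2 (fun x => r * f x).
Proof.
move=> [mf f2]; split; first exact: measurable_funM.
have -> : (fun x => ((r * f x) ^+ 2)%:E) = (fun x => (r ^+ 2 * f x ^+ 2)%:E).
  by apply/funext => x; rewrite exprMn.
exact: L1onZ.
Qed.

(** On a bounded interval constants are integrable, and [|f| <= 1 + f^2]. *)
Lemma L2_L1_itv f x y : kdv_L2 f -> L1on `[x, y] f.
Proof.
move=> Lf; apply: (@L1on_dom _ _ (fun t => 1 + f t ^+ 2)) => //.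
- exact: L2_measurable Lf.
- move=> t _; rewrite -(real_normK (num_real (f t))).
  by have := sqr_ge0 (`|f t| - 1); have := normr_ge0 (f t); nra.
- apply: L1onD => //; first exact: L1on_cst_itv.
  by apply: L1onT => //; case: Lf.
Qed.

Lemma Rintegral_itv_split f x y z : x <= y -> y <= z -> L1on `[x, z] f ->
  Rintegral mu `[x, z] f = Rintegral mu `[x, y] f + Rintegral mu `[y, z] f.
Proof.
move=> xy yz fi.
have := @Rintegral_itvB R f (BLeft x) (BRight z) y fi.
rewrite !bnd_simp => /(_ xy yz) h.
rewrite Rintegral_itv_obnd_cbnd in h; first by rewrite -h; ring.
apply: integrableS fi => //.
by apply: subset_itvr; rewrite bnd_simp.
Qed.

Lemma Rintegral_itv_sub f x y z t : x <= z -> z <= t -> t <= y ->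
  L1on `[x, y] f -> (forall s, 0 <= f s) ->
  Rintegral mu `[z, t] f <= Rintegral mu `[x, y] f.
Proof.
move=> xz zt ty fi f0.
have zy := le_trans zt ty.
have fi' : L1on `[z, y] f.
  by apply: L1onS fi => //; apply: subset_itvr; rewrite bnd_simp.
rewrite (Rintegral_itv_split xz zy fi) (Rintegral_itv_split zt ty fi').
have h1 : 0 <= Rintegral mu `[x, z] f by apply: Rintegral_ge0.
have h2 : 0 <= Rintegral mu `[t, y] f by apply: Rintegral_ge0.
by ilra.
Qed.

Lemma Rintegral_itv_cst x y r : x <= y -> \int[mu]_(_ in `[x, y]) r = r * (y - x).
Proof.
move=> xy; rewrite Rintegral_cst//= lebesgue_measure_itv/=.
case: ifPn => [//|]; rewrite lte_fin -leNgt => yx.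
have -> : x = y by apply/eqP; rewrite eq_le xy yx.
by rewrite subrr mulr0.
Qed.

(** Cauchy-Schwarz against the constant 1: integrate [(|f| - r)^2 >= 0] with [r] the mean of [|f|]
    over the interval. *)
Lemma Rintegral_norm_sqr_le f x y : x <= y -> kdv_L2 f ->
  (\int[mu]_(t in `[x, y]) `|f t|) ^+ 2 <=
  (y - x) * \int[mu]_(t in `[x, y]) (f t ^+ 2).
Proof.
move=> xy Lf; set I := \int[mu]_(t in _) _; set J := \int[mu]_(t in _) _.
have [xy'|] := ltrP x y; last first.
  move=> yx; have xyE : x = y by apply/eqP; rewrite eq_le xy yx.
  by rewrite /I xyE set_itv1 Rintegral_set1 expr0n/= subrr mul0r.
have If : L1on `[x, y] (fun t => `|f t|) by apply/L1on_norm/L2_L1_itv.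
have If2 : L1on `[x, y] (fun t => f t ^+ 2) by apply: L1onT; case: Lf.
pose r := I / (y - x).
have : 0 <= \int[mu]_(t in `[x, y]) ((f t ^+ 2 + (- (2 * r)) * `|f t|) + r ^+ 2).
  apply: Rintegral_ge0 => t _; rewrite -(real_normK (num_real (f t))).
  have -> : `|f t| ^+ 2 + - (2 * r) * `|f t| + r ^+ 2 = (`|f t| - r) ^+ 2 by iring.
  exact: sqr_ge0.
have i2 : L1on `[x, y] (fun t => - (2 * r) * `|f t|) by apply: L1onZ.
have i3 : L1on `[x, y] (fun t => r ^+ 2) by apply: L1on_cst_itv.
have i1 : L1on `[x, y] (fun t => f t ^+ 2 + - (2 * r) * `|f t|) by apply: L1onD.
rewrite (RintegralD _ i1 i3)// (RintegralD _ If2 i2)// (RintegralZl _ _ If)//.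
rewrite Rintegral_itv_cst// -/I -/J.
have d0 : y - x != 0 by rewrite subr_eq0 gt_eqF.
have -> : J + - (2 * r) * I + r ^+ 2 * (y - x) = J - I ^+ 2 / (y - x).
  by rewrite /r; field.
by rewrite subr_ge0 ler_pdivrMr ?subr_gt0// mulrC.
Qed.

(* Cutting [x, y] into n equal pieces gives |D y - D x| <= (y - x) (V y - V x) / n. *)
Lemma squeeze_increment_cst (D V : R -> R) x y : x <= y ->
  (forall z t, x <= z -> z <= t -> t <= y ->
     `|D t - D z| <= (t - z) * (V t - V z)) -> D x = D y.
Proof.
move=> xy H; apply/eqP; rewrite eq_sym -subr_eq0 -normr_le0.
apply/ler_addgt0Pl => e e0; rewrite addr0.
set M := (y - x) * (V y - V x).
(* Using [n.+1] pieces keeps the mesh [h] well defined even when the bound [n] is 0; [M / n.+1 < e]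
   is all that is wanted. *)
pose n := Num.bound `|M / e|.
have Mn : M / e < n.+1%:R.
  apply: le_lt_trans (ler_norm _) (lt_le_trans (archi_boundP (normr_ge0 _)) _).
  by rewrite ler_nat -/n leqnSn.
have n0 : 0 < n.+1%:R :> R by rewrite ltr0n.
pose h := (y - x) / n.+1%:R.
have h0 : 0 <= h by rewrite divr_ge0 ?subr_ge0// ltW.
have hE : x + n.+1%:R * h = y by rewrite /h mulrC divfK ?gt_eqF// addrC subrK.
have step k : (k <= n.+1)%N ->
    `|D (x + k%:R * h) - D x| <= h * (V (x + k%:R * h) - V x).
  elim: k => [|k IH] kn; first by rewrite mul0r addr0 !subrr normr0 mulr0.
  have {}IH := IH (ltnW kn).
  have := H (x + k%:R * h) (x + k.+1%:R * h).
  have -> : x + k.+1%:R * h - (x + k%:R * h) = h by rewrite -natr1; ring.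
  have k0 : x <= x + k%:R * h by rewrite lerDl mulr_ge0.
  have kk : x + k%:R * h <= x + k.+1%:R * h.
    by rewrite lerD2l ler_wpM2r// ler_nat.
  have ky : x + k.+1%:R * h <= y by rewrite -hE lerD2l ler_wpM2r// ler_nat.
  move=> /(_ k0 kk ky) Hk.
  have := ler_normD (D (x + k.+1%:R * h) - D (x + k%:R * h)) (D (x + k%:R * h) - D x).
  have -> : D (x + k.+1%:R * h) - D (x + k%:R * h) + (D (x + k%:R * h) - D x) =
    D (x + k.+1%:R * h) - D x by ring.
  by lra.
have := step n.+1 (leqnn _); rewrite hE => /le_trans; apply.
have -> : h * (V y - V x) = M / n.+1%:R by rewrite /h /M; ring.
by rewrite ler_pdivrMr// mulrC -ler_pdivrMr// ltW.
Qed.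

(** The relation [A' = a] in integrated form, which is how [kdv_isH2] expresses derivatives. *)
Definition primitive_of A a := forall x y, x <= y -> A y - A x = Rintegral mu `[x, y] a.

Lemma primitive_of_dist A a x y z t : kdv_L2 a -> primitive_of A a ->
  x <= z -> z <= t -> t <= y -> `|A t - A z| <= \int[mu]_(s in `[x, y]) `|a s|.
Proof.
move=> La Aa xz zt ty; rewrite Aa//.
apply: le_trans (le_normr_Rintegral _ (L2_L1_itv z t La)) _ => //.
by apply: Rintegral_itv_sub => //; apply/L1on_norm/L2_L1_itv.
Qed.

(** The product minus its candidate primitive [H] has increments of second order in the length of
    the interval. With [V] a primitive of [a^2 + b^2], [squeeze_increment_cst] makes this difference
    constant, without any pointwise differentiation. *)
Lemma primitive_ofM A B a b : kdv_L2 A -> kdv_L2 B -> kdv_L2 a -> kdv_L2 b ->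
  primitive_of A a -> primitive_of B b ->
  primitive_of (fun x => A x * B x) (fun x => a x * B x + A x * b x).
Proof.
move=> LA LB La Lb Aa Bb x0 y0 xy0.
pose h t := a t * B t + A t * b t.
pose w t := a t ^+ 2 + b t ^+ 2.
have ih : L1on setT h by apply: L1onD => //; apply: L2M.
have ia2 : L1on setT (fun t => a t ^+ 2) by case: La.
have ib2 : L1on setT (fun t => b t ^+ 2) by case: Lb.
have iw : L1on setT w by apply: L1onD.
pose H x := Rintegral mu `[x0, x] h.
pose V x := Rintegral mu `[x0, x] w.
suff E : A x0 * B x0 - H x0 = A y0 * B y0 - H y0.
  have H0 : H x0 = 0 by rewrite /H set_itv1 Rintegral_set1.
  have -> : Rintegral mu `[x0, y0] h = H y0 by [].
  by rewrite H0 in E; ilra.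
apply: (@squeeze_increment_cst (fun x => A x * B x - H x) V) => // x y x0x xy yy0.
have -> : V y - V x = Rintegral mu `[x, y] w.
  by rewrite /V (Rintegral_itv_split x0x xy) ?addKr ?[_ + _ - _]addrC ?addKr//;
    apply: L1onT.
have HE : H y - H x = Rintegral mu `[x, y] h.
  by rewrite /H (Rintegral_itv_split x0x xy) ?[_ + _ - _]addrC ?addKr//;
    apply: L1onT.
have ia := L2_L1_itv x y La; have ib := L2_L1_itv x y Lb.
(* Splits [A y * B y - A x * B x] as [B y * (A y - A x) + A x * (B y - B x)], so that [B] is frozen
   at the right end and [A] at the left end. *)
have inc : A y * B y - H y - (A x * B x - H x) =
    \int[mu]_(t in `[x, y]) (B y * a t + A x * b t - h t).
  rewrite RintegralB//; last by apply: L1onT.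
    rewrite RintegralD//; try exact: L1onZ.
    rewrite !RintegralZl//.
    rewrite -HE -(Aa x y)// -(Bb x y)//; iring.
  by apply: L1onD => //; apply: L1onZ.
(* |B y - B t| <= Ib and |A t - A x| <= Ia, so the increment is at most 2 Ia Ib, which
   Cauchy-Schwarz bounds by (y - x) * int_x^y (a^2 + b^2). *)
rewrite inc; set Ia := \int[mu]_(t in `[x, y]) `|a t|.
set Ib := \int[mu]_(t in `[x, y]) `|b t|.
have iA : L1on `[x, y] (fun t => `|a t|) by apply: L1on_norm.
have iB : L1on `[x, y] (fun t => `|b t|) by apply: L1on_norm.
have iinc : L1on `[x, y] (fun t => B y * a t + A x * b t - h t).
  apply: L1onB => //; last by apply: L1onT.
  by apply: L1onD => //; apply: L1onZ.
have ibd : L1on `[x, y] (fun t => Ib * `|a t| + Ia * `|b t|).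
  by apply: L1onD => //; apply: L1onZ.
apply: le_trans (le_normr_Rintegral _ iinc) _ => //.
apply: (@le_trans _ _ (\int[mu]_(t in `[x, y]) (Ib * `|a t| + Ia * `|b t|))).
  apply: le_Rintegral => //; first exact: L1on_norm.
  move=> t; rewrite /= in_itv/= => /andP[xt ty].
  have -> : B y * a t + A x * b t - h t = (B y - B t) * a t - (A t - A x) * b t.
    by rewrite /h; iring.
  apply: le_trans (ler_normB _ _) _; rewrite !normrM.
  by apply: lerD; apply: ler_wpM2r => //; apply: primitive_of_dist.
rewrite RintegralD//; try exact: L1onZ.
rewrite !RintegralZl// -/Ia -/Ib /w RintegralD//; try exact: L1onT.
have := Rintegral_norm_sqr_le xy La; have := Rintegral_norm_sqr_le xy Lb.
rewrite -/Ia -/Ib; have := sqr_ge0 (Ia - Ib); inra.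
Qed.

End L2.

(** * Integrable functions with integrable derivative on the whole line *)

Section Decay.
Context {R : realType}.
Local Notation mu := (@lebesgue_measure R).
Implicit Types (f g h : R -> R) (x y r : R).

(** Dominated convergence, with [|h|] as dominating function. The endpoints are arbitrary sequences
    because they will be points where another function happens to be small. *)
Lemma cvg_Rintegral_itv h (a b : R ^nat) : L1on setT h ->
  (forall n, a n <= - n%:R) -> (forall n, n%:R <= b n) ->
  Rintegral mu `[a n, b n] h @[n --> \oo] --> Rintegral mu setT h.
Proof.
move=> ih an bn.
have -> : (fun n => Rintegral mu `[a n, b n] h) =
    fine \o (fun n => (\int[mu]_x ((h \_ `[a n, b n]) x)%:E)%E).
  by apply/funext => n; rewrite /= Rintegral_mkcond.
apply: fine_cvg; rewrite fineK; last exact: integrable_fin_num.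
apply: (@dominated_cvg _ _ _ mu setT _ _ _ (fun x => `|h x|%:E)) => //.
- move=> n; apply/measurable_EFinP/(measurable_restrictT _ _).1 => //.
  by apply: measurable_funTS; exact: L1on_measurable ih.
- move=> x _; apply: cvg_near_cst; near=> n.
  rewrite patchE mem_set//= in_itv/=.
  have : `|x| <= n%:R by near: n; exact: nbhs_infty_ger.
  rewrite ler_norml => /andP[xn nx]; apply/andP; split.
    exact: le_trans (an n) xn.
  exact: le_trans nx (bn n).
- exact: L1on_norm.
- move=> n x _ /=; rewrite lee_fin patchE; case: ifPn => // _.
  by rewrite normr0.
Unshelve. all: by end_near. Qed.

Lemma Rintegral_le_setT f D : measurable D -> L1on setT f -> (forall x, 0 <= f x) ->
  Rintegral mu D f <= Rintegral mu setT f.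
Proof.
move=> mD fi f0; apply: fine_le.
- by apply: integrable_fin_num => //; apply: L1onT.
- exact: integrable_fin_num.
- apply: ge0_subset_integral => //; first exact: measurable_int fi.
  by move=> x _; rewrite lee_fin.
Qed.

(** Markov's inequality: if [|g| >= r] throughout the interval, its integral would be at least
    [r * (y - x)]. *)
Lemma L1_small_point g x y r : L1on setT g -> 0 < r -> x <= y ->
  \int[mu]_t `|g t| < r * (y - x) -> exists2 z, x <= z <= y & `|g z| < r.
Proof.
move=> ig r0 xy; set G := \int[mu]_t _ => GL; apply: contrapT => H.
have ign : L1on setT (fun t => `|g t|) by apply: L1on_norm.
have le : \int[mu]_(t in `[x, y]) `|g t| <= G by apply: Rintegral_le_setT.
suff : r * (y - x) <= \int[mu]_(t in `[x, y]) `|g t|.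
  by move=> /le_trans/(_ le); rewrite leNgt GL.
rewrite -Rintegral_itv_cst//; apply: le_Rintegral => //.
- exact: L1on_cst_itv.
- exact: L1onT.
- move=> t; rewrite /= in_itv/= => txy; rewrite leNgt; apply/negP => gt.
  by apply: H; exists t.
Qed.

Lemma L1_small_point_right g x r : L1on setT g -> 0 < r ->
  exists2 z, x <= z & `|g z| < r.
Proof.
move=> ig r0; pose G := \int[mu]_t `|g t|.
(* The length [(|G| + 1) / r] is chosen so that [r] times it exceeds [G]. *)
have xL : x <= x + (`|G| + 1) / r by rewrite lerDl divr_ge0 ?addr_ge0// ltW.
have GL : G < r * (x + (`|G| + 1) / r - x).
  rewrite [x + _ - x]addrC addKr mulrC divfK ?gt_eqF//.
  by rewrite (le_lt_trans (ler_norm _))// ltrDl.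
by have [z /andP[xz _] gz] := L1_small_point ig r0 xL GL; exists z.
Qed.

Lemma L1_small_point_left g x r : L1on setT g -> 0 < r ->
  exists2 z, z <= x & `|g z| < r.
Proof.
move=> ig r0; pose G := \int[mu]_t `|g t|.
have xL : x - (`|G| + 1) / r <= x by rewrite gerBl divr_ge0 ?addr_ge0// ltW.
have GL : G < r * (x - (x - (`|G| + 1) / r)).
  rewrite subKr mulrC divfK ?gt_eqF//.
  by rewrite (le_lt_trans (ler_norm _))// ltrDl.
by have [z /andP[_ zx] gz] := L1_small_point ig r0 xL GL; exists z.
Qed.

(** To the right of [x] there is a point where [|g| < e], and between [x] and that point [g] changes
    by at most the integral of [|h|]. *)
Lemma primitive_L1_sup g h : L1on setT g -> L1on setT h -> primitive_of g h ->
  forall x, `|g x| <= \int[mu]_t `|h t|.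
Proof.
move=> ig ih gh x; apply/ler_addgt0Pl => e e0.
have [y xy gy] := L1_small_point_right x ig e0.
have -> : g x = g y - (g y - g x) by ring.
apply: le_trans (ler_normB _ _) _; apply: lerD; first exact: ltW.
rewrite gh//; apply: le_trans (le_normr_Rintegral _ _) _ => //.
  exact: L1onT.
by apply: Rintegral_le_setT => //; apply: L1on_norm.
Qed.

(** No boundary terms at infinity: [g] tends to 0 along suitable endpoints [a n] and [b n] that
    leave every bounded set, and the integral of [h] between them is [g (b n) - g (a n)]. *)
Lemma primitive_L1_Rintegral0 g h : L1on setT g -> L1on setT h ->
  primitive_of g h -> Rintegral mu setT h = 0.
Proof.
move=> ig ih gh.
have [a aP] : {a : R ^nat & forall n, a n <= - n%:R /\ `|g (a n)| < harmonic n}.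
  apply: (@choice _ _ (fun n z => z <= - n%:R /\ `|g z| < harmonic n)) => n.
  by have [z ? ?] := L1_small_point_left (- n%:R) ig (harmonic_gt0 n); exists z.
have [b bP] : {b : R ^nat & forall n, n%:R <= b n /\ `|g (b n)| < harmonic n}.
  apply: (@choice _ _ (fun n z => n%:R <= z /\ `|g z| < harmonic n)) => n.
  by have [z ? ?] := L1_small_point_right n%:R ig (harmonic_gt0 n); exists z.
have ab n : a n <= b n.
  apply: le_trans (proj1 (aP n)) (le_trans _ (proj1 (bP n))).
  by rewrite (@le_trans _ _ 0)// oppr_le0.
have := cvg_Rintegral_itv ih (fun n => proj1 (aP n)) (fun n => proj1 (bP n)).
under eq_fun do rewrite -gh//.
move=> cv; apply: (cvg_unique _ cv) => //.
apply: (@squeeze_cvgr _ _ _ _ (fun n => - (2 * harmonic n)) (fun n => 2 * harmonic n)).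
- near=> n; rewrite -ler_norml; apply: le_trans (ler_normB _ _) _.
  by have := (proj2 (aP n)); have := proj2 (bP n); lra.
- rewrite -oppr0 -(mulr0 2); apply: cvgN; apply: cvgMr; exact: cvg_harmonic.
- rewrite -(mulr0 2); apply: cvgMr; exact: cvg_harmonic.
Unshelve. all: by end_near. Qed.

End Decay.

(** * The homogeneous nonlinearity *)

Section PrimF.
Context {R : realType}.
Local Notation mu := (@lebesgue_measure R).
Implicit Types (f g : R -> R) (x y r s p : R).

(** The fundamental theorem of calculus for [G]. Homogeneity is asked only at positive points, so
    the lemma also applies to the reflection of [f]; at 0 only continuity of [G] from the right is
    used. *)
Lemma Rintegral_homogeneous_pos p g s : 0 < p -> continuous g ->
  (forall t, 0 < t -> g t = t `^ p * g 1) -> 0 <= s ->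
  Rintegral mu `[0, s] g = g 1 / (p + 1) * s `^ (p + 1).
Proof.
move=> p0 cg gE; rewrite le_eqVlt => /predU1P[<-|s0].
  by rewrite set_itv1 Rintegral_set1 powR0 ?mulr0// gt_eqF// addr_gt0.
have p1 : p + 1 != 0 by rewrite gt_eqF// addr_gt0.
pose G t := g 1 / (p + 1) * t `^ (p + 1).
have dG x : 0 < x -> is_derive x (1 : R) G (g x).
  move=> x0; rewrite gE//.
  have -> : x `^ p * g 1 = g 1 / (p + 1) *: ((p + 1) * x `^ (p + 1 - 1)) :> R.
    by rewrite /GRing.scale/= addrK mulrA divfK// mulrC.
  by apply: is_deriveZ; exact: is_derive1_powR.
rewrite /Rintegral (@continuous_FTC2 _ g G)//.
- rewrite /= /G powR0; last by rewrite gt_eqF// addr_gt0.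
  by rewrite mulr0 subr0.
- exact: continuous_subspaceT.
- split.
  + by move=> x; rewrite in_itv/= => /andP[x0 _]; have [] := dG _ x0.
  + have -> : G 0 = g 1 / (p + 1) * 0 by rewrite /G powR0// gt_eqF// addr_gt0.
    by apply: cvgMr; apply: powR_cvg0; rewrite addr_gt0.
  + apply: cvg_at_left_filter; apply: differentiable_continuous.
    by apply/derivable1_diffP; have [] := dG _ s0.
- move=> x; rewrite in_itv/= => /andP[x0 _].
  by rewrite derive1E; have [_ ->] := dG _ x0.
Qed.

Lemma kdv_C2_continuous f : kdv_C2 f -> continuous f.
Proof.
move=> [df _] x; apply: differentiable_continuous; exact/derivable1_diffP.
Qed.

(** The reflection [t -> - t] reduces the negative half-line to the positive one. Scaling,
    measurability and growth of F are all read off this formula. *)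
Lemma kdv_primF_homogeneous p f : 0 < p -> kdv_C2 f -> kdv_homogeneous p f ->
  exists A B, forall s,
    kdv_primF f s = if 0 <= s then A * s `^ (p + 1) else B * (- s) `^ (p + 1).
Proof.
move=> p0 /kdv_C2_continuous cf hf.
exists (f 1 / (p + 1)), (- (f (-1) / (p + 1))) => s; rewrite /kdv_primF.
have [s0|s0] := lerP 0 s.
  apply: Rintegral_homogeneous_pos => // t t0.
  by rewrite -{1}(mulr1 t) hf.
have cfN : continuous (f \o -%R).
  by move=> x; apply: continuous_comp; [exact: opp_continuous | exact: cf].
have -> : Rintegral mu `[s, 0] f = Rintegral mu `[0, - s] (f \o -%R).
  have := @integration_by_substitution_oppr R f 0 (- s).
  rewrite oppr0 opprK /Rintegral => -> //; first by rewrite oppr_ge0 ltW.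
  exact: continuous_subspaceT.
rewrite (@Rintegral_homogeneous_pos p)//=.
- by rewrite mulNr.
- by move=> t t0; rewrite -hf// mulrN mulr1.
- by rewrite oppr_ge0 ltW.
Qed.

End PrimF.

(** * Coercivity of I and the Sobolev bound on K *)

Section H2.
Context {R : realType}.
Local Notation mu := (@lebesgue_measure R).
Implicit Types (u v w : R -> R) (x y r s : R).

Lemma isH2_primitive u u1 u2 : kdv_isH2 u u1 u2 ->
  [/\ kdv_L2 u, kdv_L2 u1, kdv_L2 u2, primitive_of u u1 & primitive_of u1 u2].
Proof.
by move=> [Lu L1 L2 H]; split => // x y xy; have [] := H x y xy.
Qed.

Lemma L2_sqr v : kdv_L2 v -> L1on setT (fun x => v x ^+ 2).
Proof. by case. Qed.

(** The product [u * u1] and its derivative are both integrable, so the derivative has integral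
    0. *)
Lemma H2_integration_by_parts u u1 u2 : kdv_isH2 u u1 u2 ->
  \int[mu]_x (u1 x * u1 x + u x * u2 x) = 0.
Proof.
move=> /isH2_primitive[Lu Lu1 Lu2 pu pu1].
apply: (@primitive_L1_Rintegral0 _ (fun x => u x * u1 x)).
- exact: L2M.
- by apply: L1onD => //; apply: L2M.
- exact: primitive_ofM.
Qed.

(** The derivative [2 u u1] of [u^2] is bounded in absolute value by [u^2 + u1^2]. *)
Lemma H2_sup u u1 u2 x : kdv_isH2 u u1 u2 ->
  u x ^+ 2 <= \int[mu]_t (u t ^+ 2 + u1 t ^+ 2).
Proof.
move=> /isH2_primitive[Lu Lu1 Lu2 pu pu1].
have ih : L1on setT (fun t => u1 t * u t + u t * u1 t).
  by apply: L1onD => //; apply: L2M.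
have := primitive_L1_sup (L2M Lu Lu) ih (primitive_ofM Lu Lu Lu1 Lu1 pu pu) x.
rewrite -expr2 normrX real_normK ?num_real// => /le_trans; apply.
apply: le_Rintegral => //; first exact: L1on_norm.
  by apply: L1onD => //; apply: L2_sqr.
move=> t _; rewrite ler_norml; have := sqr_ge0 (u t - u1 t).
by have := sqr_ge0 (u t + u1 t); nra.
Qed.

(** Adding [2 k] times the vanishing integral of [u1^2 + u u2] turns the integrand into [(u2 + k
    u)^2 + (2 k - beta) u1^2 + (K^2 - k^2) u^2], where [K^2 = 1 - c^2]. Any [k >= 0] strictly
    between [beta / 2] and [K] makes both last coefficients positive. *)
Lemma kdv_Ifun_coercive beta c : c ^+ 2 < 1 -> beta < 2 * Num.sqrt (1 - c ^+ 2) ->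
  exists2 d, 0 < d & forall u u1 u2, kdv_isH2 u u1 u2 ->
    d * \int[mu]_x (u x ^+ 2 + u1 x ^+ 2) <= kdv_Ifun beta c u u1 u2.
Proof.
move=> c1; set K := Num.sqrt _ => bK.
have K0 : 0 < K by rewrite sqrtr_gt0 subr_gt0.
have KE : 1 - c ^+ 2 = K ^+ 2 by rewrite sqr_sqrtr// subr_ge0 ltW.
have [k [k0 kK kb]] : exists k, [/\ 0 <= k, k < K & beta < 2 * k].
  (* The midpoint of [beta / 2] and [K], cut off at 0 so that [k < K] yields [k^2 < K^2]. *)
  exists (Num.max 0 ((beta / 2 + K) / 2)); rewrite /Num.max.
  by case: ifPn => h; split => //; lra.
pose d := Num.min (2 * k - beta) (K ^+ 2 - k ^+ 2).
have d0 : 0 < d by rewrite lt_min !subr_gt0 kb/= ltr_pXn2r// ?nnegrE ltW.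
exists d => // u u1 u2 H.
have ibp := H2_integration_by_parts H.
have [Lu Lu1 Lu2 _ _] := isH2_primitive H.
have iu := L2_sqr Lu; have iu1 := L2_sqr Lu1; have iu2 := L2_sqr Lu2.
have id : L1on setT (fun x => u x ^+ 2 + u1 x ^+ 2) by apply: L1onD.
have iI : L1on setT
    (fun x => u2 x ^+ 2 - beta * u1 x ^+ 2 + (1 - c ^+ 2) * u x ^+ 2).
  by apply: L1onD => //; [apply: L1onB => // |]; apply: L1onZ.
have ip : L1on setT (fun x => u1 x * u1 x + u x * u2 x).
  by apply: L1onD => //; apply: L2M.
have -> : kdv_Ifun beta c u u1 u2 = \int[mu]_x
    (u2 x ^+ 2 - beta * u1 x ^+ 2 + (1 - c ^+ 2) * u x ^+ 2 +
      2 * k * (u1 x * u1 x + u x * u2 x)).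
  rewrite RintegralD//; last by apply: L1onZ.
  by rewrite RintegralZl// ibp mulr0 addr0.
rewrite -RintegralZl//; apply: le_Rintegral => //; first exact: L1onZ.
  by apply: L1onD => //; apply: L1onZ.
move=> x _; rewrite KE.
have d1 : d <= 2 * k - beta by rewrite /d ge_min lexx.
have d2 : d <= K ^+ 2 - k ^+ 2 by rewrite /d ge_min lexx orbT.
have h1 := ler_wpM2r (sqr_ge0 (u1 x)) d1.
have h2 := ler_wpM2r (sqr_ge0 (u x)) d2.
have h3 := sqr_ge0 (u2 x + k * u x).
have -> : u2 x ^+ 2 - beta * u1 x ^+ 2 + K ^+ 2 * u x ^+ 2 +
  2 * k * (u1 x * u1 x + u x * u2 x) = (u2 x + k * u x) ^+ 2 +
  (2 * k - beta) * u1 x ^+ 2 + (K ^+ 2 - k ^+ 2) * u x ^+ 2 by ring.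
by rewrite mulrDr; lra.
Qed.

End H2.

(** * Scaling and growth of F, and the bound on K *)

Section Kfun.
Context {R : realType}.
Local Notation mu := (@lebesgue_measure R).
Implicit Types (f u v w : R -> R) (x y r s l p : R).

Lemma kdv_primF_scale p f l s : 0 < p -> kdv_C2 f -> kdv_homogeneous p f ->
  0 < l -> kdv_primF f (l * s) = l `^ (p + 1) * kdv_primF f s.
Proof.
move=> p0 cf hf l0; have [A [B FE]] := kdv_primF_homogeneous p0 cf hf.
rewrite !FE pmulr_rge0//; case: (lerP 0 s) => s0.
  by rewrite powRM ?(ltW l0)// mulrCA.
by rewrite -mulrN powRM ?(ltW l0)// ?oppr_ge0 ?ltW// mulrCA.
Qed.

Lemma kdv_primF0 p f : 0 < p -> kdv_C2 f -> kdv_homogeneous p f -> kdv_primF f 0 = 0.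
Proof.
move=> p0 cf hf; have [A [B ->]] := kdv_primF_homogeneous p0 cf hf.
by rewrite lexx powR0 ?mulr0// gt_eqF// addr_gt0.
Qed.

Lemma measurable_kdv_primF p f : 0 < p -> kdv_C2 f -> kdv_homogeneous p f ->
  measurable_fun setT (kdv_primF f).
Proof.
move=> p0 cf hf; have [A [B FE]] := kdv_primF_homogeneous p0 cf hf.
rewrite (funext FE); apply: measurable_fun_ifT.
- exact: measurable_fun_ler.
- by apply: measurable_funM => //; exact: measurable_powR.
- apply: measurable_funM => //.
  by apply: (measurableT_comp (measurable_powR _)).
Qed.

Lemma kdv_primF_bound p f : 0 < p -> kdv_C2 f -> kdv_homogeneous p f ->
  exists2 C, 0 <= C & forall s, `|kdv_primF f s| <= C * `|s| `^ (p + 1).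
Proof.
move=> p0 cf hf; have [A [B FE]] := kdv_primF_homogeneous p0 cf hf.
exists (`|A| + `|B|); first by rewrite addr_ge0.
move=> s; rewrite FE; case: (lerP 0 s) => s0; rewrite normrM (ger0_norm (powR_ge0 _ _)).
  by rewrite (ger0_norm s0); apply: ler_wpM2r; rewrite ?powR_ge0// lerDl.
by rewrite (ltr0_norm s0); apply: ler_wpM2r; rewrite ?powR_ge0// lerDr.
Qed.

(** Write [|u|^(p+1) = |u|^(p-1) u^2] and apply the Sobolev bound [H2_sup] to the first factor only;
    the factor [u^2] remains to be integrated. *)
Lemma H2_powR_le p u u1 u2 x : 1 < p -> kdv_isH2 u u1 u2 ->
  `|u x| `^ (p + 1) <=
  (\int[mu]_t (u t ^+ 2 + u1 t ^+ 2)) `^ ((p - 1) / 2) * u x ^+ 2.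
Proof.
move=> p1 H; set S := \int[mu]_t _.
have uS : u x ^+ 2 <= S by exact: H2_sup H.
have -> : p + 1 = (p - 1) + 2%:R by rewrite -[2%:R]/(1 + 1 : R); ring.
rewrite powRD; last by rewrite gt_eqF//; lra.
rewrite powR_mulrn// real_normK ?num_real//; apply: ler_wpM2r; first exact: sqr_ge0.
have -> : `|u x| `^ (p - 1) = (u x ^+ 2) `^ ((p - 1) / 2).
  rewrite -(real_normK (num_real (u x))) -powR_mulrn// -powRrM; congr (_ `^ _).
  by field.
apply: ge0_ler_powR => //; first by lra.
  by rewrite nnegrE sqr_ge0.
by rewrite nnegrE (le_trans _ uS)// sqr_ge0.
Qed.

Lemma L1_kdv_primF p f u u1 u2 : 1 < p -> kdv_C2 f -> kdv_homogeneous p f ->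
  kdv_isH2 u u1 u2 -> L1on setT (fun x => kdv_primF f (u x)).
Proof.
move=> p1 cf hf H; have p0 : 0 < p by exact: lt_trans p1.
have [C C0 FC] := kdv_primF_bound p0 cf hf.
have [Lu _ _ _] := H.
apply: (@L1on_dom _ _ _ (fun x => C * (_ * u x ^+ 2))) => //.
- by apply: (measurableT_comp (measurable_kdv_primF p0 cf hf)); case: Lu.
- move=> x _; apply: le_trans (FC _) _; apply: ler_wpM2l => //.
  exact: H2_powR_le p1 H.
- by do 2 apply: L1onZ => //; exact: L2_sqr.
Qed.

Lemma kdv_Kfun_bound p f : 1 < p -> kdv_C2 f -> kdv_homogeneous p f ->
  exists2 C, 0 < C & forall u u1 u2, kdv_isH2 u u1 u2 ->
    kdv_Kfun p f u <= C * (\int[mu]_x (u x ^+ 2 + u1 x ^+ 2)) `^ ((p + 1) / 2).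
Proof.
move=> p1 cf hf; have p0 : 0 < p by exact: lt_trans p1.
have [C C0 FC] := kdv_primF_bound p0 cf hf.
(* [C + 1] in place of [C] makes the constant strictly positive, since [kdv_ratio_bound] divides by
   a power of it. *)
exists ((p + 1) * (C + 1)); first by apply: mulr_gt0; [exact: addr_gt0 | exact: ltr_wpDl].
move=> u u1 u2 H; set S := \int[mu]_x _.
have [Lu Lu1 _ _] := H; have iu := L2_sqr Lu; have iu1 := L2_sqr Lu1.
have S0 : 0 <= S by apply: Rintegral_ge0 => x _; rewrite addr_ge0// sqr_ge0.
rewrite /kdv_Kfun -mulrA; apply: ler_wpM2l; first by rewrite addr_ge0// ltW.
pose M := (C + 1) * S `^ ((p - 1) / 2).
have M0 : 0 <= M by rewrite mulr_ge0 ?powR_ge0// addr_ge0.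
apply: (@le_trans _ _ (\int[mu]_x (M * u x ^+ 2))).
  apply: le_Rintegral => //; first exact: (L1_kdv_primF p1 cf hf H).
    exact: L1onZ.
  move=> x _; apply: le_trans (ler_norm _) (le_trans (FC _) _).
  rewrite /M -mulrA; apply: ler_pM => //; rewrite ?powR_ge0 ?lerDl//.
  exact: H2_powR_le p1 H.
rewrite RintegralZl//.
have -> : (p + 1) / 2 = (p - 1) / 2 + 1 by field.
rewrite -(@mulr_powRB1 _ S); [|done|by lra].
rewrite addrK /M -mulrA; apply: ler_wpM2l; first by rewrite addr_ge0.
rewrite [S * _]mulrC; apply: ler_wpM2l; first exact: powR_ge0.
apply: le_Rintegral => //; first by apply: L1onD.
by move=> x _; rewrite lerDl sqr_ge0.
Qed.

End Kfun.

(** * A trial function with K > 0 *)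

Section Trial.
Context {R : realType}.
Local Notation mu := (@lebesgue_measure R).
Implicit Types (f u v w : R -> R) (x y r s l p : R).

Lemma continuous_primitive_of g g1 : continuous (g1 : R -> R) ->
  (forall x : R, is_derive x (1 : R) g (g1 x)) -> primitive_of g g1.
Proof.
move=> cg1 dg x y; rewrite le_eqVlt => /predU1P[<-|xy].
  by rewrite subrr set_itv1 Rintegral_set1.
have cg z : {for z, continuous g}.
  by apply: differentiable_continuous; apply/derivable1_diffP; have [] := dg z.
rewrite /Rintegral (@continuous_FTC2 _ g1 g)//.
- exact: continuous_subspaceT.
- split.
  + by move=> z _; have [] := dg z.
  + by apply: cvg_at_right_filter; exact: cg.
  + by apply: cvg_at_left_filter; exact: cg.
- by move=> z _; rewrite derive1E; have [_ ->] := dg z.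
Qed.

(** By evenness the integral is twice that over the half-line, which is finite. *)
Lemma L1_oneDsqrV : L1on setT (fun x : R => (oneDsqr x)^-1).
Proof.
have cw : continuous (fun x : R => (oneDsqr x)^-1) by exact: continuous_oneDsqrV.
apply/integrableP; split.
  by apply/measurable_EFinP; apply: continuous_measurable_fun; exact: cw.
have w0 (x : R) : 0 <= (oneDsqr x)^-1 by rewrite invr_ge0.
under eq_integral do rewrite gee0_abs ?lee_fin//.
rewrite ge0_symfun_integralT//; last first.
  by move=> x; rewrite /= /oneDsqr sqrrN.
by rewrite -set_itvcy integral0y_oneDsqr -EFinM ltry.
Qed.

Lemma L2_le_oneDsqrV (g : R -> R) r : continuous g ->
  (forall x, g x ^+ 2 <= r * (oneDsqr x)^-1) -> kdv_L2 g.
Proof.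
move=> cg gr; have mg : measurable_fun setT g by exact: continuous_measurable_fun.
split => //; apply: (@L1on_dom _ _ _ (fun x => r * (oneDsqr x)^-1)) => //.
- exact: measurable_funX.
- by move=> x _; rewrite ger0_norm ?sqr_ge0.
- exact/L1onZ/L1_oneDsqrV.
Qed.

(** With [w = 1 / (1 + x^2)], both derivatives are polynomials in [x] and [w], and [w <= 1],
    [x^2 w <= 1] bound their squares by multiples of [w]. This positive function serves both as the
    profile of the trial function and as the multiplier in the uniqueness of weak derivatives. *)
Lemma isH2_oneDsqrV : exists w1 w2, kdv_isH2 (fun x : R => (oneDsqr x)^-1) w1 w2.
Proof.
pose w x : R := (oneDsqr x)^-1.
have cw : continuous w by exact: continuous_oneDsqrV.
have cid : continuous (fun x : R => x) by move=> x; exact: cvg_id.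
have ccst r : continuous (fun _ : R => r) by move=> x; exact: cvg_cst.
have cM (g h : R -> R) : continuous g -> continuous h -> continuous (fun x => g x * h x).
  by move=> cg ch x; apply: cvgM; [exact: cg | exact: ch].
have cD (g h : R -> R) : continuous g -> continuous h -> continuous (fun x => g x + h x).
  by move=> cg ch x; apply: cvgD; [exact: cg | exact: ch].
have dw x : is_derive x (1 : R) w (-2 * x * (w x * w x)).
  have x0 : oneDsqr x != 0 by rewrite gt_eqF// (lt_le_trans ltr01).
  rewrite /w /oneDsqr; apply: is_derive_eq; rewrite /GRing.scale/=.
  by rewrite /oneDsqr in x0; field.
pose w1 x := -2 * x * (w x * w x).
pose w2 x := -2 * (w x * w x) + 8 * (x * x) * (w x * w x * w x).
have dw1 x : is_derive x (1 : R) w1 (w2 x).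
  have := dw x => dwx; apply: is_derive_eq; rewrite /GRing.scale/= /w2; ring.
have cww := cM _ _ cw cw.
have cw1 : continuous w1 := cM _ _ (cM _ _ (ccst (-2)) cid) cww.
have cw2 : continuous w2 := cD _ _ (cM _ _ (ccst (-2)) cww)
  (cM _ _ (cM _ _ (ccst 8) (cM _ _ cid cid)) (cM _ _ cww cw)).
have w0 x : 0 < w x by rewrite invr_gt0 (lt_le_trans ltr01).
have wE x : w x + x ^+ 2 * w x = 1.
  have -> : w x + x ^+ 2 * w x = w x * oneDsqr x by rewrite /oneDsqr; ring.
  by rewrite mulVf// gt_eqF// (lt_le_trans ltr01).
have wle x : w x <= 1 by exact: oneDsqrV_le1.
have xwle x : x ^+ 2 * w x <= 1 by rewrite -(wE x) lerDr ltW.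
have xw0 x : 0 <= x ^+ 2 * w x by rewrite mulr_ge0 ?sqr_ge0 ?ltW.
have ww0 x : 0 <= w x * w x by rewrite mulr_ge0 ?ltW.
have ww1 x : w x * w x <= 1 by apply: mulr_ile1; rewrite ?wle ?ltW.
exists w1, w2; split.
- apply: (@L2_le_oneDsqrV w 1) => // x; rewrite mul1r -/(w x).
  by have := w0 x; have := wle x; nra.
- apply: (@L2_le_oneDsqrV w1 4) => // x; rewrite -/(w x) /w1.
  have -> : (-2 * x * (w x * w x)) ^+ 2 = 4 * (x ^+ 2 * w x * (w x * w x)) * w x by ring.
  apply: ler_wpM2r; first exact: ltW.
  rewrite -[leRHS]mulr1; apply: ler_wpM2l => //.
  exact: mulr_ile1.
- apply: (@L2_le_oneDsqrV w2 64) => // x; rewrite -/(w x).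
  (* [w2 = a w^2] with [a] between -2 and 6, so [a^2 <= 64] holds with room to spare. *)
  pose a := -2 + 8 * (x ^+ 2 * w x).
  have -> : w2 x ^+ 2 = a ^+ 2 * (w x * w x * w x) * w x by rewrite /w2 /a; ring.
  apply: ler_wpM2r; first exact: ltW.
  rewrite -[leRHS]mulr1; apply: ler_pM; rewrite ?sqr_ge0//.
  + by rewrite mulr_ge0// ltW.
  + by have := xw0 x; have := xwle x; rewrite /a; nra.
  + by apply: mulr_ile1 => //; exact: ltW.
- move=> x y xy; split.
    exact: (continuous_primitive_of cw1 dw).
  exact: (continuous_primitive_of cw2 dw1).
Qed.

Lemma isH2Z r u u1 u2 : kdv_isH2 u u1 u2 ->
  kdv_isH2 (fun x => r * u x) (fun x => r * u1 x) (fun x => r * u2 x).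
Proof.
move=> /isH2_primitive[Lu Lu1 Lu2 pu pu1]; split; try exact: L2Z.
move=> x y xy; rewrite -!mulrBr pu// pu1//.
by rewrite !RintegralZl//; exact: L2_L1_itv.
Qed.

(** For a positive profile [w], homogeneity gives [F(s w) = w^(p+1) F(s)], so one point [s] with
    [F(s) > 0] makes F positive along the whole function [s w]. *)
Lemma exists_Kfun_gt0 p f : 1 < p -> kdv_C2 f -> kdv_homogeneous p f ->
  (exists s, 0 < kdv_primF f s) ->
  exists u u1 u2, kdv_isH2 u u1 u2 /\ 0 < kdv_Kfun p f u.
Proof.
move=> p1 cf hf [s Fs]; have p0 : 0 < p by exact: lt_trans p1.
have [w1 [w2 Hw]] := isH2_oneDsqrV.
exists (fun x => s * (oneDsqr x)^-1), (fun x => s * w1 x), (fun x => s * w2 x).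
have Hu := isH2Z s Hw; split => //.
rewrite /kdv_Kfun; apply: mulr_gt0; first by rewrite addr_gt0.
have iF := L1_kdv_primF p1 cf hf Hu.
have w0 (x : R) : 0 < (oneDsqr x)^-1 by rewrite invr_gt0 (lt_le_trans ltr01).
have FE x : kdv_primF f (s * (oneDsqr x)^-1) =
    (oneDsqr x)^-1 `^ (p + 1) * kdv_primF f s.
  by rewrite mulrC (kdv_primF_scale _ p0 cf hf).
(* On [[0, 1]] the profile is at least 1/2, which gives a strictly positive lower bound. *)
apply: (@lt_le_trans _ _ (\int[mu]_(x in `[0, 1]) (2^-1 `^ (p + 1) * kdv_primF f s))).
  by rewrite Rintegral_itv_cst// subr0 mulr1 mulr_gt0// powR_gt0.
apply: (@le_trans _ _ (\int[mu]_(x in `[0, 1]) kdv_primF f (s * (oneDsqr x)^-1))).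
  apply: le_Rintegral => //.
  - exact: L1on_cst_itv.
  - exact: L1onT.
  move=> x; rewrite /= in_itv/= => /andP[x0 x1]; rewrite FE; apply: ler_wpM2r.
    exact: ltW.
  have o0 : 0 < oneDsqr x by rewrite -invr_gt0.
  have o2 : oneDsqr x <= 2 by rewrite /oneDsqr; have := exprn_ile1 2 x0 x1; lra.
  apply: ge0_ler_powR.
  - by rewrite addr_ge0 ?ltW.
  - by rewrite nnegrE invr_ge0.
  - by rewrite nnegrE ltW.
  - by rewrite lef_pV2 ?posrE.
apply: Rintegral_le_setT => // x; rewrite FE.
by rewrite mulr_ge0 ?powR_ge0 ?ltW.
Qed.

End Trial.

(** * Uniqueness of weak derivatives *)

Section Uniqueness.
Context {R : realType}.
Local Notation mu := (@lebesgue_measure R).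
Implicit Types (f g h u v w : R -> R) (x y r s l p : R).

Lemma ae_imply (P Q : R -> Prop) : (forall x, P x -> Q x) ->
  {ae mu, forall x, P x} -> {ae mu, forall x, Q x}.
Proof. by move=> PQ; apply: filterS; first exact: (ae_filter_ringOfSetsType mu). Qed.

(** The cumulative integral [F] is constant, and by Lebesgue differentiation its derivative is [g]
    almost everywhere. *)
Lemma L1_Rintegral_itv0 g : L1on setT g ->
  (forall x y, x <= y -> Rintegral mu `[x, y] g = 0) -> {ae mu, forall x, g x = 0}.
Proof.
move=> ig g0; pose F x := \int[mu]_(t in `]-oo, x]) g t.
have Fle x y : x <= y -> F x = F y.
  move=> xy; have igy : L1on `]-oo, y] g by apply: L1onT.
  have := @Rintegral_itvB R g -oo%O (BRight y) x igy.
  rewrite !bnd_simp => /(_ isT xy).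
  rewrite Rintegral_itv_obnd_cbnd ?g0//; last by apply: L1onT.
  by move/eqP; rewrite subr_eq0 => /eqP/esym.
have F0 : F = cst (F 0).
  by apply/funext => x; case: (lerP x 0) => [|/ltW]; move/Fle.
have lg : locally_integrable setT g by apply: open_integrable_locally => //; exact: openT.
have igy y : mu.-integrable `]-oo, y] (EFin \o g) by apply: L1onT.
have := FTC1Ny igy lg; apply: ae_imply => x [_].
by rewrite -/F F0 derive1_cst.
Qed.

Lemma isH2B u u1 u2 w w1 w2 : kdv_isH2 u u1 u2 -> kdv_isH2 w w1 w2 ->
  kdv_isH2 (fun x => u x - w x) (fun x => u1 x - w1 x) (fun x => u2 x - w2 x).
Proof.
move=> /isH2_primitive[Lu Lu1 Lu2 pu pu1] /isH2_primitive[Lw Lw1 Lw2 pw pw1].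
have L2B f g : kdv_L2 f -> kdv_L2 g -> kdv_L2 (fun x => f x - g x).
  move=> Lf Lg; have := L2D Lf (L2Z (-1) Lg).
  by congr kdv_L2; apply/funext => x; rewrite mulN1r.
split; try exact: L2B.
move=> x y xy; rewrite !RintegralB//; try exact: L2_L1_itv.
by rewrite -pu// -pw// -pu1// -pw1//; split; ring.
Qed.

Lemma Rintegral_eq0_ae g : L1on setT g -> (forall x, 0 <= g x) ->
  Rintegral mu setT g = 0 -> {ae mu, forall x, g x = 0}.
Proof.
move=> ig g0 I0.
have E : (\int[mu]_x `|(g x)%:E| = 0)%E.
  under eq_integral do rewrite gee0_abs ?lee_fin//.
  by rewrite -(fineK (integrable_fin_num _ ig))//; congr EFin.
have mg : measurable_fun setT (EFin \o g) by exact: measurable_int ig.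
have := (ae_eq_integral_abs mu measurableT mg).1 E.
by apply: ae_imply => x /= /(_ I) [].
Qed.

Lemma ae_eq_Rintegral f g : measurable_fun setT f -> measurable_fun setT g ->
  {ae mu, forall x, f x = g x} -> Rintegral mu setT f = Rintegral mu setT g.
Proof.
move=> mf mg fg; congr fine; apply: ae_eq_integral => //; try exact/measurable_EFinP.
by move: fg; apply: ae_imply => x /= -> _.
Qed.

(** Integration by parts with [u = 0] gives [u1 = 0] almost everywhere. The sup bound for [u1^2],
    whose derivative [2 u1 u2] is then almost everywhere 0, upgrades this to every point. *)
Lemma isH2_derivative_eq0 u1 u2 : kdv_isH2 (fun=> 0) u1 u2 ->
  (forall x, u1 x = 0) /\ {ae mu, forall x, u2 x = 0}.
Proof.
move=> H; have [L0 Lu1 Lu2 p0 p1] := isH2_primitive H.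
have u10 : {ae mu, forall x, u1 x * u1 x = 0}.
  apply: Rintegral_eq0_ae; first exact: L2M.
    by move=> x; rewrite -expr2 sqr_ge0.
  rewrite -[RHS](H2_integration_by_parts H).
  by apply: eq_Rintegral => x _; rewrite mul0r addr0.
have ih : L1on setT (fun t => u2 t * u1 t + u1 t * u2 t).
  by apply: L1onD => //; apply: L2M.
have u1E x : u1 x = 0.
  have := primitive_L1_sup (L2M Lu1 Lu1) ih (primitive_ofM Lu1 Lu1 Lu2 Lu2 p1 p1) x.
  rewrite (@ae_eq_Rintegral _ (cst 0)).
  - rewrite Rintegral_cst// mul0r normr_le0 mulf_eq0 orbb => /eqP; exact.
  - exact: L1on_measurable (L1on_norm ih).
  - exact: measurable_cst.
  - move: u10; apply: ae_imply => t /eqP; rewrite mulf_eq0 orbb => /eqP ->.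
    by rewrite mulr0 mul0r addr0 normr0.
split => //.
(* Multiplying by a positive H2 function turns [u2] into an L1 function whose
   integrals over intervals still vanish. *)
have [w1 [w2 Hw]] := @isH2_oneDsqrV R.
have [Lw Lw1 _ pw _] := isH2_primitive Hw.
have p2 : primitive_of (fun=> 0) u2 by move=> x y xy; rewrite -p1// !u1E.
have L12 := L2M Lu2 Lw.
have : {ae mu, forall x, u2 x * (oneDsqr x)^-1 = 0}.
  apply: L1_Rintegral_itv0 => // x y xy.
  have := primitive_ofM L0 Lw Lu2 Lw1 p2 pw xy.
  rewrite !mul0r subrr => ->; apply: eq_Rintegral => t _.
  by rewrite mul0r addr0.
apply: ae_imply => x /eqP; rewrite mulf_eq0 invr_eq0 => /orP[/eqP//|].
by rewrite gt_eqF// (lt_le_trans ltr01).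
Qed.

(** [kdv_groundState] chooses the derivatives existentially, so I must not depend on the choice. The
    differences of two choices are derivatives of the zero function. *)
Lemma kdv_Ifun_unique beta c u u1 u2 w1 w2 :
  kdv_isH2 u u1 u2 -> kdv_isH2 u w1 w2 ->
  kdv_Ifun beta c u u1 u2 = kdv_Ifun beta c u w1 w2.
Proof.
move=> Hu Hw; have := isH2B Hu Hw.
have -> : (fun x => u x - u x) = (fun=> 0) by apply/funext => x; rewrite subrr.
move=> /isH2_derivative_eq0[E1 E2].
have [mu0 mu1 mu2 _] := Hu; have [_ mw1 mw2 _] := Hw.
apply: ae_eq_Rintegral.
- apply: measurable_funD; last by apply: measurable_funM => //; apply: measurable_funX; case: mu0.
  apply: measurable_funB; first by apply: measurable_funX; case: mu2.
  by apply: measurable_funM => //; apply: measurable_funX; case: mu1.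
- apply: measurable_funD; last by apply: measurable_funM => //; apply: measurable_funX; case: mu0.
  apply: measurable_funB; first by apply: measurable_funX; case: mw2.
  by apply: measurable_funM => //; apply: measurable_funX; case: mw1.
- move: E2; apply: ae_imply => x /eqP; rewrite subr_eq0 => /eqP ->.
  by have /eqP := E1 x; rewrite subr_eq0 => /eqP ->.
Qed.

End Uniqueness.

(** Both sides carry [k] to the power [- 2 / (p - 1)]. The left side is K of the dilation in
    [exists_Nehari_ratio], with [a] and [k] the values of I and K. *)
Lemma powR_ratio (R : realType) (p a k : R) : 1 < p -> 0 < a -> 0 < k ->
  (a / k) `^ ((p + 1) / (p - 1)) * k =
  (a / k `^ (2 / (p + 1))) `^ ((p + 1) / (p - 1)).
Proof.
move=> p1 a0 k0; have kV0 : 0 <= k^-1 by rewrite invr_ge0 ltW.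
rewrite (powRM _ (ltW a0) kV0) -powRN (powRM _ (ltW a0) (powR_ge0 k _)) -mulrA.
congr (_ * _); rewrite -(powR_inv1 (ltW k0)) -!powRrM -[X in _ * X](powRr1 (ltW k0)).
rewrite -powRD; last by rewrite (gt_eqF k0) implybT.
by congr (_ `^ _); field; rewrite !gt_eqF// ?subr_gt0//; lra.
Qed.

(** * The Nehari set *)

Section GroundStates.
Context {R : realType}.
Local Notation mu := (@lebesgue_measure R).
Context (p beta c : R) (f : R -> R).
Context (p1 : 1 < p) (cf : kdv_C2 f) (hf : kdv_homogeneous p f).
Context (c1 : c ^+ 2 < 1) (betac : beta < 2 * Num.sqrt (1 - c ^+ 2)).
Implicit Types (u v : R -> R) (r : R).

Local Notation I := (kdv_Ifun beta c).
Local Notation K := (kdv_Kfun p f).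
Local Notation m := (kdv_mval p f beta c).

Let p0 : 0 < p. Proof. exact: lt_trans p1. Qed.
Let pD1 : 0 < p + 1. Proof. exact: addr_gt0. Qed.
Let pB1 : 0 < p - 1. Proof. by rewrite subr_gt0. Qed.
Let pD1n0 : p + 1 != 0. Proof. by rewrite gt_eqF. Qed.
Let pB1n0 : p - 1 != 0. Proof. by rewrite gt_eqF. Qed.

Lemma L1_Ifun_integrand u u1 u2 : kdv_isH2 u u1 u2 -> L1on setT
  (fun x => u2 x ^+ 2 - beta * u1 x ^+ 2 + (1 - c ^+ 2) * u x ^+ 2).
Proof.
move=> [/L2_sqr iu /L2_sqr iu1 /L2_sqr iu2 _].
by apply: L1onD => //; [apply: L1onB => // |]; apply: L1onZ.
Qed.

Lemma L2_combination u v : kdv_L2 u -> kdv_L2 v -> kdv_L2 (fun x => c * u x + v x).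
Proof. by move=> Lu Lv; apply: L2D => //; exact: L2Z. Qed.

(** Completing the square: [u^2 + v^2 + 2 c u v = (1 - c^2) u^2 + (c u + v)^2]. *)
Lemma kdv_LfunE u u1 u2 v : kdv_isH2 u u1 u2 -> kdv_L2 v ->
  kdv_Lfun p f beta c u u1 u2 v =
  2^-1 * I u u1 u2 + 2^-1 * \int[mu]_x (c * u x + v x) ^+ 2 - K u / (p + 1).
Proof.
move=> H Lv; have [Lu _ _ _] := H.
have iI := L1_Ifun_integrand H.
have iJ : L1on setT (fun x => (c * u x + v x) ^+ 2) by exact/L2_sqr/L2_combination.
have iuv := L2M Lu Lv; have iF := L1_kdv_primF p1 cf hf H.
rewrite /kdv_Lfun /kdv_Qfun /kdv_Kfun mulrAC divff// mul1r.
have -> : kdv_Efun p f beta u u1 u2 v = \int[mu]_x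
   (2^-1 * (u2 x ^+ 2 - beta * u1 x ^+ 2 + (1 - c ^+ 2) * u x ^+ 2) +
    2^-1 * (c * u x + v x) ^+ 2 - (c * (u x * v x) + kdv_primF f (u x))).
  by apply: eq_Rintegral => x _; field.
rewrite RintegralB//; last 2 first.
  by apply: L1onD => //; apply: L1onZ.
  by apply: L1onD => //; apply: L1onZ.
rewrite RintegralD//; [|exact: L1onZ|exact: L1onZ].
rewrite RintegralD//; last exact: L1onZ.
rewrite !RintegralZl// -/(kdv_Ifun beta c u u1 u2).
by rewrite /kdv_Ifun; iring.
Qed.

Lemma kdv_IfunZ r u u1 u2 : kdv_isH2 u u1 u2 ->
  I (fun x => r * u x) (fun x => r * u1 x) (fun x => r * u2 x) = r ^+ 2 * I u u1 u2.
Proof.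
move=> H; rewrite /kdv_Ifun -RintegralZl//; last exact: L1_Ifun_integrand.
by apply: eq_Rintegral => x _; ring.
Qed.

Lemma kdv_KfunZ r u u1 u2 : 0 < r -> kdv_isH2 u u1 u2 ->
  K (fun x => r * u x) = r `^ (p + 1) * K u.
Proof.
move=> r0 H; rewrite /kdv_Kfun mulrCA; congr (_ * _).
rewrite -RintegralZl//; last exact: (L1_kdv_primF p1 cf hf H).
by apply: eq_Rintegral => x _; exact: (kdv_primF_scale _ p0 cf hf r0).
Qed.

(** With [S] the squared H1 norm, [I >= d S] and [K^(2/(p+1)) <= C^(2/(p+1)) S], so [S] cancels in
    the quotient. *)
Lemma kdv_ratio_bound : exists2 b, 0 < b & forall u u1 u2, kdv_isH2 u u1 u2 ->
  0 < K u -> b <= I u u1 u2 / K u `^ (2 / (p + 1)).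
Proof.
have [d d0 Id] := kdv_Ifun_coercive c1 betac.
have [C C0 KC] := kdv_Kfun_bound p1 cf hf.
exists (d / C `^ (2 / (p + 1))); first by rewrite divr_gt0// powR_gt0.
move=> u u1 u2 H K0; have := Id _ _ _ H; have := KC _ _ _ H.
set S := \int[mu]_x _ => KS dS.
have S0 : 0 <= S by apply: Rintegral_ge0 => x _; rewrite addr_ge0// sqr_ge0.
rewrite ler_pdivlMr ?powR_gt0//; apply: le_trans dS.
rewrite mulrAC ler_pdivrMr ?powR_gt0// -mulrA; apply: ler_wpM2l; first exact: ltW.
have q0 : 0 <= 2 / (p + 1) by rewrite divr_ge0 ?ltW.
have CS0 : 0 <= C * S `^ ((p + 1) / 2) by rewrite mulr_ge0 ?powR_ge0 ?ltW.
have := ge0_ler_powR q0 (ltW K0) CS0 KS.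
rewrite (powRM _ (ltW C0) (powR_ge0 S _)) -powRrM.
have -> : (p + 1) / 2 * (2 / (p + 1)) = 1 by field.
by rewrite powRr1// [C `^ _ * S]mulrC.
Qed.

Lemma kdv_mval_le u u1 u2 : kdv_isH2 u u1 u2 -> 0 < K u ->
  m <= I u u1 u2 / K u `^ (2 / (p + 1)).
Proof.
move=> H K0; apply: ge_inf; last by exists u, u1, u2.
have [b _ bI] := kdv_ratio_bound.
by exists b => _ [w [w1 [w2 [Hw Kw ->]]]]; exact: bI.
Qed.

Lemma kdv_mval_powR_le u u1 u2 : kdv_isH2 u u1 u2 -> 0 < K u -> 0 <= m ->
  I u u1 u2 <= K u -> m `^ ((p + 1) / (p - 1)) <= K u.
Proof.
move=> H K0 m0 IK.
have mK : m <= K u `^ ((p - 1) / (p + 1)).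
  apply: le_trans (kdv_mval_le H K0) _; rewrite ler_pdivrMr ?powR_gt0//.
  rewrite -powRD; last by rewrite (gt_eqF K0) implybT.
  have -> : (p - 1) / (p + 1) + 2 / (p + 1) = 1 by field.
  by rewrite powRr1// ltW.
have q0 : 0 <= (p + 1) / (p - 1) by rewrite divr_ge0 ?ltW.
have := ge0_ler_powR q0 m0 (powR_ge0 _ _) mK.
rewrite -powRrM.
have -> : (p - 1) / (p + 1) * ((p + 1) / (p - 1)) = 1.
  by field; rewrite pD1n0 pB1n0.
by rewrite powRr1// ltW.
Qed.

(** Replacing the integral of [(c u + v)^2] by [K - I] cancels I in L and leaves
    [K / 2 - K / (p + 1)]. *)
Lemma kdv_Nehari_Lfun u u1 u2 v : kdv_isH2 u u1 u2 -> kdv_L2 v ->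
  kdv_Pfun p f beta c u u1 u2 v = 0 ->
  kdv_Lfun p f beta c u u1 u2 v = (p - 1) / (2 * (p + 1)) * K u.
Proof.
move=> H Lv; rewrite kdv_LfunE// /kdv_Pfun => P0.
have -> : \int[mu]_x (c * u x + v x) ^+ 2 = K u - I u u1 u2.
  by rewrite /kdv_Kfun /kdv_Ifun in P0 *; ilra.
by field.
Qed.

(** Here [K = I + J] with both terms nonnegative. If [K <= 0] both vanish; coercivity then kills
    [u], and [J = 0] kills [v], against nontriviality. *)
Lemma kdv_Nehari_Kfun_gt0 u u1 u2 v : kdv_inN p f beta c u u1 u2 v -> 0 < K u.
Proof.
move=> [H Lv nz]; rewrite /kdv_Pfun; set J := \int[mu]_x _ => P0.
have [d d0 Id] := kdv_Ifun_coercive c1 betac.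
have [Lu Lu1 _ _] := H; have := Id _ _ _ H; set S := \int[mu]_x _ => dS.
have LJ := L2_combination Lu Lv.
have J0 : 0 <= J by apply: Rintegral_ge0 => x _; rewrite sqr_ge0.
have S0 : 0 <= S by apply: Rintegral_ge0 => x _; rewrite addr_ge0// sqr_ge0.
have dS0 : 0 <= d * S by rewrite mulr_ge0// ltW.
have IJK : K u = I u u1 u2 + J by move: P0; generalize J (I u u1 u2) (K u) => ? ? ? ?; lra.
rewrite ltNge; apply/negP => K0; apply: nz.
have SE : S = 0.
  apply/eqP; rewrite eq_le S0 andbT -(pmulr_rle0 _ d0) (le_trans dS)//.
  by move: IJK K0 J0; generalize J (I u u1 u2) (K u) => ? ? ? ? ? ?; lra.
have JE : J = 0.
  apply/eqP; rewrite eq_le J0 andbT.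
  by move: IJK K0 dS dS0; generalize J (I u u1 u2) (K u) (d * S) => ? ? ? ? ? ? ? ?; lra.
have iS : L1on setT (fun x => u x ^+ 2 + u1 x ^+ 2) by apply: L1onD => //; apply: L2_sqr.
have u0 : {ae mu, forall x, u x = 0}.
  have := Rintegral_eq0_ae iS (fun x => addr_ge0 (sqr_ge0 _) (sqr_ge0 _)) SE.
  apply: ae_imply => x /eqP; rewrite paddr_eq0 ?sqr_ge0// => /andP[+ _].
  by rewrite sqrf_eq0 => /eqP.
split => //.
have := Rintegral_eq0_ae (L2_sqr LJ) (fun x => sqr_ge0 _) JE.
have fF := ae_filter_ringOfSetsType mu.
move: u0; apply: filterS2 => x -> /eqP.
by rewrite sqrf_eq0 mulr0 add0r => /eqP.
Qed.

Lemma kdv_Nehari_mval_le u u1 u2 v : 0 <= m -> kdv_inN p f beta c u u1 u2 v ->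
  m `^ ((p + 1) / (p - 1)) <= K u.
Proof.
move=> m0 N; have K0 := kdv_Nehari_Kfun_gt0 N; have [H Lv _ P0] := N.
apply: (kdv_mval_powR_le H) => //; move: P0; rewrite /kdv_Pfun; set J := \int[mu]_x _.
have : 0 <= J by apply: Rintegral_ge0 => x _; rewrite sqr_ge0.
by generalize J (I u u1 u2) (K u) => ? ? ? ? ?; lra.
Qed.

Context (Fpos : exists s, 0 < kdv_primF f s).

(** The trial function ensures that the infimum is not taken over the empty set, so the uniform
    bound passes to it. *)
Lemma kdv_mval_gt0 : 0 < m.
Proof.
have [b b0 bI] := kdv_ratio_bound.
apply: lt_le_trans b0 _; apply: lb_le_inf.
  have [u [u1 [u2 [H K0]]]] := exists_Kfun_gt0 p1 cf hf Fpos.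
  by eexists; exists u, u1, u2; split => //; reflexivity.
by move=> _ [w [w1 [w2 [Hw Kw ->]]]]; exact: bI.
Qed.

(* The dilation of [u] by [(I u / K u) ^ (1 / (p - 1))] lands on the Nehari set. *)
Lemma exists_Nehari_ratio u u1 u2 : kdv_isH2 u u1 u2 -> 0 < K u ->
  exists w w1 w2 v, kdv_inN p f beta c w w1 w2 v /\
    K w = (I u u1 u2 / K u `^ (2 / (p + 1))) `^ ((p + 1) / (p - 1)).
Proof.
move=> H K0.
have I0 : 0 < I u u1 u2.
  have := lt_le_trans kdv_mval_gt0 (kdv_mval_le H K0).
  by rewrite pmulr_lgt0// invr_gt0 powR_gt0.
set a := I u u1 u2; set k := K u.
(* The solution of [r^2 a = r^(p+1) k], that is, of [I = K] after dilation by [r]. *)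
pose r := (a / k) `^ (1 / (p - 1)).
have r0 : 0 < r by rewrite powR_gt0// divr_gt0.
have Hr := isH2Z r H; have [Lr _ _ _] := Hr.
have KE := kdv_KfunZ r0 H.
have rB : r `^ (p - 1) = a / k.
  by rewrite -powRrM divfK// powRr1// ltW// divr_gt0.
have IE : I (fun x => r * u x) (fun x => r * u1 x) (fun x => r * u2 x) =
    K (fun x => r * u x).
  rewrite (kdv_IfunZ r H)// KE -/a -/k.
  have -> : p + 1 = (p - 1) + 2%:R by rewrite -[2%:R]/(1 + 1 : R); ring.
  rewrite powRD; last by rewrite (gt_eqF r0) implybT.
  rewrite powR_mulrn ?(ltW r0)// rB [RHS]mulrAC divfK ?(gt_eqF K0)//.
  by rewrite [LHS]mulrC.
exists (fun x => r * u x), (fun x => r * u1 x), (fun x => r * u2 x),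
  (fun x => - c * (r * u x)); split.
  split => //; first exact: L2Z.
  - move=> [u0 _]; have : K (fun x => r * u x) = 0.
      rewrite /kdv_Kfun (@ae_eq_Rintegral _ _ (cst 0)).
      + by rewrite Rintegral_cst// mul0r mulr0.
      + exact: L1on_measurable (L1_kdv_primF p1 cf hf Hr).
      + exact: measurable_cst.
      + by move: u0; apply: ae_imply => x /= ->; exact: (kdv_primF0 p0 cf hf).
    by rewrite KE => /eqP; rewrite mulf_eq0 (gt_eqF K0) powR_eq0 (gt_eqF r0).
  - rewrite /kdv_Pfun IE subrr add0r.
    under eq_Rintegral do rewrite mulNr subrr expr0n/=.
    by rewrite Rintegral_cst// mul0r.
rewrite KE -/k -powRrM.
have -> : 1 / (p - 1) * (p + 1) = (p + 1) / (p - 1) by rewrite div1r mulrC.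
exact: powR_ratio.
Qed.

(** The lower bound is [kdv_Nehari_mval_le]. If it were strict, some ratio close enough to [m]
    would, after dilation onto the Nehari set, give a value of L below the infimum. *)
Lemma kdv_infLNE :
  kdv_infLN p f beta c = (p - 1) / (2 * (p + 1)) * m `^ ((p + 1) / (p - 1)).
Proof.
set t := _ / _; have t0 : 0 < t by rewrite divr_gt0// mulr_gt0.
have m0 := kdv_mval_gt0.
set N := [set r | exists u u1 u2 v, kdv_inN p f beta c u u1 u2 v /\
  r = kdv_Lfun p f beta c u u1 u2 v].
have lbN : lbound N (t * m `^ ((p + 1) / (p - 1))).
  move=> _ [u [u1 [u2 [v [uN ->]]]]]; have [H Lv _ P0] := uN.
  rewrite (kdv_Nehari_Lfun H Lv P0); apply: ler_wpM2l; first exact: ltW.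
  exact: (kdv_Nehari_mval_le (ltW m0) uN).
have N0 u u1 u2 : kdv_isH2 u u1 u2 -> 0 < K u ->
    N (t * (I u u1 u2 / K u `^ (2 / (p + 1))) `^ ((p + 1) / (p - 1))).
  move=> H K0; have [w [w1 [w2 [v [wN <-]]]]] := exists_Nehari_ratio H K0.
  exists w, w1, w2, v; split => //; have [Hw Lv _ P0] := wN.
  by rewrite (kdv_Nehari_Lfun Hw Lv P0).
have [u [u1 [u2 [H K0]]]] := exists_Kfun_gt0 p1 cf hf Fpos.
apply/eqP; rewrite eq_le; apply/andP; split; last first.
  by apply: lb_le_inf => //; eexists; exact: N0 H K0.
rewrite leNgt; apply/negP => mN.
(* Inverting [rho -> t * rho^((p+1)/(p-1))] turns the strict inequality into [m < X^((p-1)/(p+1))],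
   and the definition of [m] supplies a ratio in between. *)
pose X := kdv_infLN p f beta c / t.
have q0 : 0 < (p - 1) / (p + 1) by rewrite divr_gt0.
have qq : (p + 1) / (p - 1) * ((p - 1) / (p + 1)) = 1 by field; rewrite pD1n0 pB1n0.
have mX : m `^ ((p + 1) / (p - 1)) < X by rewrite ltr_pdivlMr// mulrC.
have X0 : 0 < X by apply: le_lt_trans mX; exact: powR_ge0.
have : m < X `^ ((p - 1) / (p + 1)).
  have := gt0_ltr_powR q0 (powR_ge0 _ _) (ltW X0) mX.
  by rewrite -powRrM qq powRr1// ltW.
move=> /inf_lt []; first by eexists; exists u, u1, u2; split => //; reflexivity.
move=> _ [w [w1 [w2 [Hw Kw ->]]]]; set rho := I w w1 w2 / _ => rhoX.
have rho0 : 0 <= rho.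
  exact: le_trans (ltW m0) (kdv_mval_le Hw Kw).
have rX : rho `^ ((p + 1) / (p - 1)) < X.
  have q1 : 0 < (p + 1) / (p - 1) by rewrite divr_gt0.
  have := gt0_ltr_powR q1 rho0 (powR_ge0 _ _) rhoX.
  by rewrite -powRrM [_ / _ * _]mulrC qq powRr1// ltW.
have : kdv_infLN p f beta c <= t * rho `^ ((p + 1) / (p - 1)).
  by apply: ge_inf; [exists (t * m `^ ((p + 1) / (p - 1))) | exact: N0].
by rewrite leNgt [t * _]mulrC -ltr_pdivlMr// rX.
Qed.

End GroundStates.

Theorem mainTheorem1 (R : realType) (p : R) (f : R -> R) (beta c : R)
  (u u1 u2 v : R -> R) :
  1 < p -> kdv_C2 f -> kdv_homogeneous p f -> (exists s, 0 < kdv_primF f s) ->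
  c ^+ 2 < 1 -> beta < 2 * Num.sqrt (1 - c ^+ 2) ->
  kdv_isH2 u u1 u2 -> kdv_L2 v ->
  (kdv_vecGroundState p f beta c u v <->
   (kdv_inN p f beta c u u1 u2 v /\ kdv_Lfun p f beta c u u1 u2 v = kdv_infLN p f beta c)).
Proof.
move=> p1 cf hf Fpos c1 betac H Lv.
have p0 : 0 < p by exact: lt_trans p1.
have m0 := kdv_mval_gt0 p1 cf hf c1 betac Fpos.
rewrite (kdv_infLNE p1 cf hf c1 betac Fpos).
have [Lu _ _ _] := H; have LJ := L2_combination c Lu Lv.
split => [[[phi1 [phi2 [Hphi IK KM]]] vu]|[uN]].
  have K0 : 0 < kdv_Kfun p f u by rewrite KM powR_gt0.
  have P0 : kdv_Pfun p f beta c u u1 u2 v = 0.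
    (* The ground state comes with its own derivatives [phi1] and [phi2]; I takes the same value on
       [u1] and [u2]. *)
    rewrite /kdv_Pfun (kdv_Ifun_unique beta c H Hphi) IK subrr add0r.
    rewrite (@ae_eq_Rintegral _ _ (cst 0)).
    - by rewrite Rintegral_cst// mul0r.
    - exact: L1on_measurable (L2_sqr LJ).
    - exact: measurable_cst.
    - by move: vu; apply: ae_imply => x ->; rewrite mulNr subrr expr0n.
  split; last by rewrite (kdv_Nehari_Lfun p1 cf hf H Lv P0) KM.
  split => // -[u0 _]; move: K0; rewrite /kdv_Kfun (@ae_eq_Rintegral _ _ (cst 0)).
  - by rewrite Rintegral_cst// mul0r mulr0 ltxx.
  - exact: L1on_measurable (L1_kdv_primF p1 cf hf H).
  - exact: measurable_cst.
  - by move: u0; apply: ae_imply => x ->; exact: (kdv_primF0 p0 cf hf).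
have K0 := kdv_Nehari_Kfun_gt0 c1 betac uN; have [_ _ _ P0] := uN.
rewrite (kdv_Nehari_Lfun p1 cf hf H Lv P0) => KL.
have KM : kdv_Kfun p f u = kdv_mval p f beta c `^ ((p + 1) / (p - 1)).
  by apply: mulfI KL; rewrite gt_eqF// divr_gt0 ?subr_gt0// mulr_gt0// addr_gt0.
(* Since [m = K^((p-1)/(p+1))], the inequality [m K^(2/(p+1)) <= I] reads [K <= I]. Together with
   [I - K + J = 0] and [J >= 0] this forces [J = 0] and [I = K]. *)
have KI : kdv_Kfun p f u <= kdv_Ifun beta c u u1 u2.
  have := kdv_mval_le p1 cf hf c1 betac H K0; rewrite ler_pdivlMr ?powR_gt0//.
  apply: le_trans.
  have mE : kdv_mval p f beta c = kdv_Kfun p f u `^ ((p - 1) / (p + 1)).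
    rewrite KM -powRrM.
    have -> : (p + 1) / (p - 1) * ((p - 1) / (p + 1)) = 1.
      by field; rewrite subr_eq0 !gt_eqF// addr_gt0.
    by rewrite powRr1// ltW.
  rewrite mE -powRD; last by rewrite (gt_eqF K0) implybT.
  have -> : (p - 1) / (p + 1) + 2 / (p + 1) = 1.
    by field; rewrite gt_eqF// addr_gt0.
  by rewrite powRr1// ltW.
move: P0; rewrite /kdv_Pfun; set J := Rintegral _ _ _ => P0.
have J0 : 0 <= J by apply: Rintegral_ge0 => x _; rewrite sqr_ge0.
have [JE IK] : J = 0 /\ kdv_Ifun beta c u u1 u2 = kdv_Kfun p f u.
  move: P0 KI J0; generalize J (kdv_Ifun beta c u u1 u2) (kdv_Kfun p f u).
  by move=> j i k *; split; lra.
split; first by exists u1, u2.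
have := Rintegral_eq0_ae (L2_sqr LJ) (fun x => sqr_ge0 _) JE.
apply: ae_imply => x /eqP; rewrite sqrf_eq0 addrC addr_eq0 => /eqP ->.
by rewrite mulNr.
Qed.
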